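(* Let $F$ be a polybox contained in a $d$-box $X$. If there is a proper suit for $F$ with exactly $2^d$ elements, then $F=X$.
   Context: A $d$-box is $X=X_1\times\cdots\times X_d$ with finite nonempty sets $X_i$. A box is a nonempty $A_1\times\cdots\times A_d$ with $A_i\subseteq X_i$, proper if $A_i\neq X_i$ for all $i$. Boxes $A,B$ are dichotomous if $A_i=X_i\setminus B_i$ for some $i$. A suit is a family of pairwise dichotomous boxes, proper if all its boxes are proper, and it is a suit for $F$ if its union is $F$; a nonempty $F\subseteq X$ is a polybox if some suit is a suit for $F$. *)

(* Defs.v *)
From HB Require Import structures.
From mathcomp Require Import all_boot.

Set Implicit Arguments.
Unset Strict Implicit.
Unset Printing Implicit Defensive.

(* The d-box X = X_0 x ... x X_(d-1) is the finite type of points               *)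
(* {dffun forall i, X i}; nonemptiness of the X i is a hypothesis wherever it   *)
(* is needed, since a finType may be empty.                                     *)
Section Polyboxes.

Variables (d : nat) (X : 'I_d -> finType).
Local Notation point := {dffun forall i : 'I_d, X i}.
Implicit Types (B C F : {set point}) (S : {set {set point}}).

Definition is_box B : Prop :=
  B != set0 /\ exists A : forall i, {set X i}, B = setXn A.

(* The factors of a nonempty box are determined by the box, so on boxes the     *)
(* existential quantifiers over factors below are harmless.                     *)
Definition proper_box B : Prop :=
  is_box B /\
  exists A : forall i, {set X i}, B = setXn A /\ forall i, A i <> setT.

Definition dichotomous B C : Prop :=
  exists A A' : forall i, {set X i},
    [/\ B = setXn A, C = setXn A' & exists i, A i = ~: A' i].

Definition suit S : Prop :=
  (forall B, B \in S -> is_box B) /\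
  (forall B C, B \in S -> C \in S -> B <> C -> dichotomous B C).

Definition proper_suit S : Prop :=
  suit S /\ forall B, B \in S -> proper_box B.

Definition suit_for S F : Prop := suit S /\ cover S = F.

Definition polybox F : Prop := F != set0 /\ exists S, suit_for S F.

End Polyboxes.

(* Main.v *)
Require Import Defs.
From HB Require Import structures.
From mathcomp Require Import all_boot.

(** Fix a point x. To a box B with factors A_i attach the bit vector
    ([x_i \in A_i])_i. Dichotomous boxes have complementary factors in some
    coordinate, so their vectors differ there. Hence a suit with 2^d boxes
    realises every bit vector; the box realising the all-ones vector
    contains x. *)

Section Signature.

Variables (d : nat) (X : 'I_d -> finType).
Local Notation point := {dffun forall i : 'I_d, X i}.
Implicit Types (x : point) (B : {set point}) (S : {set {set point}}).

(* Phrased through the projections of B, to avoid choosing factors for B. *)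
Definition signature x B : {ffun 'I_d -> bool} :=
  [ffun i => x i \in [set (y : point) i | y in B]].

(** Nonemptiness matters: an empty product has empty projections even when some factors are not
    empty. *)
Lemma signatureE x (A : forall i, {set X i}) (i : 'I_d) :
  setXn A != set0 -> signature x (setXn A) i = (x i \in A i).
Proof.
case/set0Pn=> b /setXnP bA; rewrite ffunE.
apply/imsetP/idP => [[y /setXnP yA ->]|xA]; first exact: yA.
(* The point [b] of the box, moved to [x i] in coordinate [i], stays in the box. *)
exists ([ffun j => dfwith (fun k => b k) (x i) j] : point).
  by apply/setXnP => j; rewrite ffunE; case: dfwithP.
by rewrite ffunE dfwith_in.
Qed.

Lemma signature_inj x S : suit S -> {in S &, injective (signature x)}.
Proof.
move=> [boxS dichS] B C BS CS eqBC.
have [//|/eqP neqBC] := eqVneq B C.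
have [A [A' [defB defC [i Ai]]]] := dichS _ _ BS CS neqBC.
have [B0 _] := boxS _ BS; have [C0 _] := boxS _ CS.
rewrite {}defB {}defC in B0 C0 eqBC.
(* At [i], equal signatures would put [x i] in [A' i] exactly when it is outside. *)
move/ffunP/(_ i): eqBC; rewrite !signatureE // Ai in_setC.
by case: (x i \in A' i).
Qed.

Lemma suit_cover_full S : suit S -> #|S| = 2 ^ d -> cover S = setT.
Proof.
move=> suitS cardS; apply/setP => x; rewrite inE.
have full : signature x @: S = [set: {ffun 'I_d -> bool}].
  (* By injectivity the image has [2 ^ d] elements, as many as there are bit vectors. *)
  apply/eqP; rewrite eqEcard subsetT cardsT card_ffun card_bool card_ord /=.
  by rewrite card_in_imset ?cardS //; apply: signature_inj.
have : [ffun => true] \in signature x @: S by rewrite full inE.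
case/imsetP=> B BS /ffunP sigB; apply/bigcupP; exists B => //.
have [B0 [A defB]] := suitS.1 _ BS.
rewrite {}defB in B0 sigB *.
by apply/setXnP => i; rewrite -signatureE // -sigB ffunE.
Qed.

End Signature.

Theorem theorem2p5 (d : nat) (X : 'I_d -> finType)
    (X_nonempty : forall i : 'I_d, 0 < #|X i|)
    (F : {set {dffun forall i : 'I_d, X i}}) (F_polybox : polybox F) :
  (exists S : {set {set {dffun forall i : 'I_d, X i}}},
     [/\ proper_suit S, suit_for S F & #|S| = 2 ^ d]) ->
  F = [set: {dffun forall i : 'I_d, X i}].
Proof.
by case=> S [_ [suitS <-] cardS]; apply: suit_cover_full.
Qed.
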